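(* Let $\varepsilon>0$. With probability $1-o\big(\exp(-\tfrac14 n^{1/2})\big)$ (as $n\to\infty$), the first two rows of a uniformly random Latin square of order $n$ contain a row cycle of length at least $n^{1/2}(\log n)^{1-\varepsilon}$.
   Context: A Latin square of order $n$ is an $n\times n$ array with symbols from $[n]$ in which each symbol occurs exactly once in each row and column. For rows $i,j$, let $\sigma_{i,j}$ be the permutation of $[n]$ with $\sigma_{i,j}(L[i,c])=L[j,c]$ for every column $c$. A row cycle of length $k$ in rows $i,j$ is the $2\times k$ subarray on rows $i,j$ and the $k$ columns $c$ whose entries $L[i,c]$ form one cycle of $\sigma_{i,j}$ (equivalently, a $2\times k$ Latin subrectangle that is minimal under containment). *)

(* Defs.v *)
From mathcomp Require Import all_boot all_order all_algebra all_fingroup.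
From mathcomp Require Import reals.

Set Implicit Arguments.
Unset Strict Implicit.
Unset Printing Implicit Defensive.

Import Order.TTheory GRing.Theory Num.Theory.
Local Open Scope ring_scope.

(* Rows, columns and symbols are all indexed from 0, by 'I_n. *)
Definition is_latin (n : nat) (L : 'M['I_n]_n) : bool :=
  [forall i, forall s, #|[set c | L i c == s]| == 1%N] &&
  [forall c, forall s, #|[set i | L i c == s]| == 1%N].

Definition latin (n : nat) := {L : 'M['I_n]_n | is_latin L}.

Lemma latin_row_inj (n : nat) (L : latin n) (i : 'I_n) :
  injective (fun c => val L i c).
Proof.
case: L => L /= /andP[/forallP rowL _] c d /= eqLcd.
have /forallP/(_ (L i c))/cards1P[e rowLe] := rowL i.
have := set11 e; rewrite -rowLe.
have /set1P -> : c \in [set e] by rewrite -rowLe inE.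
by have /set1P -> : d \in [set e] by rewrite -rowLe inE eqLcd.
Qed.

Definition latin_row (n : nat) (L : latin n) (i : 'I_n) : {perm 'I_n} :=
  perm (@latin_row_inj n L i).

(* Products of permutations compose from left to right, see sigmaE. *)
Definition sigma (n : nat) (L : latin n) (i j : 'I_n) : {perm 'I_n} :=
  ((latin_row L i)^-1 * latin_row L j)%g.

Lemma sigmaE (n : nat) (L : latin n) (i j c : 'I_n) :
  sigma L i j (val L i c) = val L j c.
Proof.
have -> : val L i c = latin_row L i c by rewrite permE.
by rewrite permM permK permE.
Qed.

(* A row cycle in rows i, j is represented by its set of columns, so that its
   length is the cardinality of that set. *)
Definition row_cycles (n : nat) (L : latin n) (i j : 'I_n) : {set {set 'I_n}} :=
  [set [set c | val L i c \in C] | C : {set 'I_n} in porbits (sigma L i j)].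

(* The event that the first two rows contain a row cycle of length at least x.
   For n <= 1 there is no second row and the event is empty. *)
Definition long_row_cycle (R : realType) (n : nat) (x : R) : {set latin n} :=
  [set L : latin n | [exists i : 'I_n, exists j : 'I_n,
     [&& i == 0%N :> nat, j == 1%N :> nat &
         [exists C in row_cycles L i j, x <= #|C|%:R]]]].

Definition uniform_pr (R : realType) (T : finType) (E : {set T}) : R :=
  #|E|%:R / #|T|%:R.

(* Main.v *)
Require Import Defs.
From mathcomp Require Import all_boot all_order all_algebra all_fingroup.
From mathcomp Require Import all_classical all_reals all_analysis.
From mathcomp Require Import zify ring lra.

(* Let N(s) be the number of Latin squares whose rows i, j satisfy
   sigma_{i,j} = s. Suppose that a and b lie in different cycles of s, and let
   c, d be the columns of a, b in row i. If rows i and j lie in different cycles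
   of the permutation taking column c to column d, exchanging the two columns
   on the cycle of row i turns s into (a b) s, which has one cycle fewer.
   Otherwise exchange rows i and j on the row cycle of b first: this multiplies
   the column permutation by a transposition, which puts rows i and j in
   different cycles. Hence N(s) <= N(s') + N(s'') with s', s'' having one cycle
   fewer, and so N(s) <= 2^K M, where K is the number of cycles of s and M is
   the maximum of N over the n-cycles. Relabelling symbols shows that N is
   conjugation invariant, and an n-cycle has at least n!/n conjugates, so
   M <= n |latin n| / n!.
   If all row cycles are shorter than x, then K >= n/x. By Burnside's lemma for
   words of length n over t letters, the sum of t^K over all permutations is at
   most n! (n+1)^t. With t = 2q this bounds the probability of having only row
   cycles shorter than x by n (n+1)^(2q) q^(-n/x), and q of order n^(1/4) is
   enough. *)

Set Implicit Arguments.
Unset Strict Implicit.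
Unset Printing Implicit Defensive.

Import Order.TTheory GRing.Theory Num.Theory.
Import numFieldNormedType.Exports.

(** * Inverting a permutation on one of its cycles *)

Lemma eq_in_porbit (T : finType) (s t : {perm T}) x :
  {in porbit s x, t =1 s} -> porbit t x = porbit s x.
Proof.
move=> eq_ts; have eqX k : (t ^+ k)%g x = (s ^+ k)%g x.
  elim: k => [|k IHk]; first by rewrite !expg0.
  by rewrite !expgSr !permM IHk eq_ts ?mem_porbit.
by apply/setP=> y; apply/porbitP/porbitP => -[k ->]; exists k; rewrite eqX.
Qed.

Section Reverse.

Variables (T : finType) (s : {perm T}) (x0 : T).
Local Notation B := (porbit s x0).

Lemma porbit_closed x : (s x \in B) = (x \in B).
Proof. by rewrite -!eq_porbit_mem -[s x]/((s ^+ 1)%g x) porbit_perm. Qed.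

Lemma porbit_closedV x : (s^-1%g x \in B) = (x \in B).
Proof. by rewrite -porbit_closed permKV. Qed.

Lemma porbit_reverse_inj :
  injective (fun x => if x \in B then s^-1%g x else s x).
Proof.
move=> x y /=; case: ifP => xB; case: ifP => yB; try exact: perm_inj.
- by move=> eq_xy; rewrite -porbit_closedV eq_xy porbit_closed yB in xB.
- by move=> eq_xy; rewrite -porbit_closed eq_xy porbit_closedV yB in xB.
Qed.

(** This is what becomes of [sigma] when the two rows are exchanged on the row cycle of [x0]. *)
Definition porbit_reverse : {perm T} := perm porbit_reverse_inj.

Lemma porbit_reverseE x :
  porbit_reverse x = if x \in B then s^-1%g x else s x.
Proof. by rewrite permE. Qed.

Lemma porbit_porbit_reverse x : porbit porbit_reverse x = porbit s x.
Proof.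
case: (boolP (x \in B)) => xB.
  rewrite -(porbitV s x); apply: eq_in_porbit => y.
  rewrite porbitV -eq_porbit_mem => /eqP yx.
  by rewrite porbit_reverseE -eq_porbit_mem yx eq_porbit_mem xB.
apply: eq_in_porbit => y; rewrite -eq_porbit_mem => /eqP yx.
by rewrite porbit_reverseE -eq_porbit_mem yx eq_porbit_mem (negPf xB).
Qed.

Lemma porbits_porbit_reverse : porbits porbit_reverse = porbits s.
Proof. by apply: eq_imset => x; apply: porbit_porbit_reverse. Qed.

End Reverse.

(** * Latin squares via injective rows and columns; transposes *)

Lemma card_fiber_inj (T : finType) (f : T -> T) (y : T) :
  injective f -> #|[set x | f x == y]| = 1.
Proof.
move=> f_inj; apply/eqP/cards1P; exists (invF f_inj y); apply/setP=> x.
by rewrite !inE; apply/eqP/eqP => [<-|->]; rewrite ?invF_f ?f_invF.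
Qed.

Lemma is_latin_tr n (L : 'M['I_n]_n) : is_latin (L^T)%R = is_latin L.
Proof.
rewrite /is_latin andbC; congr andb; apply: eq_forallb => i;
  apply: eq_forallb => s; congr (#|pred_of_set _| == _);
  by apply/setP=> c; rewrite !inE mxE.
Qed.

Definition latin_tr n (L : latin n) : latin n :=
  exist _ (val L)^T%R (etrans (is_latin_tr (val L)) (valP L)).

Lemma latin_col_inj n (L : latin n) c : injective (fun i => val L i c).
Proof.
move=> i j eq_ij; apply: (@latin_row_inj n (latin_tr L) c).
by rewrite /= !mxE.
Qed.

Lemma is_latinP n (L : 'M['I_n]_n) :
  reflect ((forall i, injective (L i)) /\ forall c, injective (L^~ c))
          (is_latin L).
Proof.
apply: (iffP idP) => [latL | [rowL colL]].
  by split=> [i|c]; [apply: (@latin_row_inj n (exist _ L latL))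
                    |apply: (@latin_col_inj n (exist _ L latL))].
apply/andP; split; apply/forallP=> i; apply/forallP=> s; apply/eqP;
  exact: card_fiber_inj.
Qed.

Lemma sigma_uniq n (L : latin n) i j (s : {perm 'I_n}) :
  (forall c, s (val L i c) = val L j c) -> sigma L i j = s.
Proof.
move=> sP; apply/permP=> x.
have -> : x = val L i ((latin_row L i)^-1 x)%g.
  by rewrite -[RHS](permE (@latin_row_inj n L i)) permKV.
by rewrite sigmaE sP.
Qed.

Definition latin_pos n (L : latin n) i a : 'I_n := ((latin_row L i)^-1 a)%g.

Lemma latin_posK n (L : latin n) i a : val L i (latin_pos L i a) = a.
Proof. by rewrite -[LHS](permE (@latin_row_inj n L i)) permKV. Qed.

Lemma latin_pos_uniq n (L : latin n) i a c : val L i c = a -> latin_pos L i a = c.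
Proof. by move=> <-; apply: (@latin_row_inj n L i); rewrite latin_posK. Qed.

(** * Exchanging two rows on a row cycle *)

Section Switch.

Variable n : nat.
Implicit Types (L : 'M['I_n]_n) (i j : 'I_n) (B : {set 'I_n}).

Definition swap_rows i j B L : 'M['I_n]_n :=
  \matrix_(r, e) L (if L i e \in B then tperm i j r else r) e.

(** The columns selected by [B] are the same seen from row [i] or row [j], so the exchange preserves
    the symbol set of each row. *)
Definition swap_closed i j B L := forall e, (L i e \in B) = (L j e \in B).

Lemma swap_rows_latin i j B L :
  swap_closed i j B L -> is_latin L -> is_latin (swap_rows i j B L).
Proof.
move=> cl /is_latinP[rowL colL]; apply/is_latinP; split=> [r e e'|e r r'];
  rewrite !mxE; last first.
  by move/colL; case: ifP => // _; apply: perm_inj.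
case: ifP => eB; case: ifP => e'B; try by apply: rowL.
all: case: tpermP => [->|->|_ _]; try by apply: rowL.
(* One column is exchanged and the other is not; by closedness exactly one of the two entries lies
   in [B]. *)
all: by move=> /(congr1 (fun x => x \in B)) /=; rewrite -?cl eB e'B.
Qed.

Lemma swap_rows_mem i j B L r e : swap_closed i j B L ->
  r = i \/ r = j -> (swap_rows i j B L r e \in B) = (L i e \in B).
Proof.
by move=> cl [] ->; rewrite mxE; case: ifP => eB; rewrite ?tpermL ?tpermR -?cl ?eB.
Qed.

Lemma swap_rowsK i j B L :
  swap_closed i j B L -> swap_rows i j B (swap_rows i j B L) = L.
Proof.
move=> cl; apply/matrixP=> r e; rewrite mxE swap_rows_mem //; last by left.
by rewrite mxE; case: ifP => eB; rewrite eB ?tpermK.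
Qed.

(** The default of [insubd] is never taken, by [val_switch]. *)
Definition switch i j s (L : latin n) : latin n :=
  insubd L (swap_rows i j (porbit (sigma L i j) s) (val L)).

Lemma porbit_sigma_closed i j s (L : latin n) :
  swap_closed i j (porbit (sigma L i j) s) (val L).
Proof. by move=> e; rewrite -(sigmaE L i j e) porbit_closed. Qed.

Lemma val_switch i j s (L : latin n) :
  val (switch i j s L) = swap_rows i j (porbit (sigma L i j) s) (val L).
Proof.
rewrite insubdK //; apply: swap_rows_latin (valP L).
exact: porbit_sigma_closed.
Qed.

Lemma switchE i j s (L : latin n) r e : val (switch i j s L) r e =
  val L (if val L i e \in porbit (sigma L i j) s then tperm i j r else r) e.
Proof. by rewrite val_switch mxE. Qed.

Lemma sigma_switch i j s (L : latin n) :
  sigma (switch i j s L) i j = porbit_reverse (sigma L i j) s.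
Proof.
apply: sigma_uniq => e; rewrite !switchE porbit_reverseE.
case: (boolP (val L i e \in _)) => eB; last by rewrite (negPf eB) sigmaE.
rewrite tpermL tpermR -(porbit_sigma_closed i j s L e) eB.
by rewrite -(sigmaE L i j e) permK.
Qed.

(** Reversing a cycle keeps its support, so the second switch acts on the same columns. *)
Lemma switchK i j s : involutive (switch i j s).
Proof.
move=> L; apply: val_inj; rewrite val_switch sigma_switch porbit_porbit_reverse.
by rewrite val_switch swap_rowsK //; apply: porbit_sigma_closed.
Qed.

End Switch.

(** * Merging two cycles of the row permutation by switching columns *)

Section Merge.

Variables (n : nat) (i j : 'I_n).
Hypothesis neq_ij : i != j.

Definition num_latin (s : {perm 'I_n}) := #|[set L : latin n | sigma L i j == s]|.

(** Rows [i] and [j] are in different cycles of the column permutation, where a row is named by its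
    entry in column [c]. *)
Definition separated (L : latin n) c d :=
  val L j c \notin porbit (sigma (latin_tr L) c d) (val L i c).

Definition col_switch c d s (L : latin n) : latin n :=
  latin_tr (switch c d s (latin_tr L)).

Lemma latin_trK : involutive (@latin_tr n).
Proof. by move=> L; apply: val_inj; rewrite /= trmxK. Qed.

Lemma col_switchK c d s : involutive (col_switch c d s).
Proof. by move=> L; rewrite /col_switch latin_trK switchK latin_trK. Qed.

Lemma col_switchE c d s L r e : val (col_switch c d s L) r e =
  val L r (if val L r c \in porbit (sigma (latin_tr L) c d) s
           then tperm c d e else e).
Proof. by rewrite mxE switchE !mxE. Qed.

(** The switch exchanges the entries of columns [c] and [d] in row [i] and, by separation, leaves
    row [j] alone. *)
Lemma sigma_col_switch (L : latin n) c d : separated L c d ->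
  sigma (col_switch c d (val L i c) L) i j =
  (tperm (val L i c) (val L i d) * sigma L i j)%g.
Proof.
move=> sepL; apply: sigma_uniq => e; rewrite !col_switchE porbit_id (negPf sepL).
rewrite permM (inj_tperm _ _ _ (@latin_row_inj n L i)) tpermK.
exact: sigmaE.
Qed.

(** The switch exchanges the positions of [a] and [b] in row [i]. Both columns can thus be read off
    the image, and the switch undone. *)
Lemma card_separated (s : {perm 'I_n}) a b :
  #|[set L : latin n | (sigma L i j == s) &&
      separated L (latin_pos L i a) (latin_pos L i b)]|
  <= num_latin (tperm a b * s)%g.
Proof.
pose f (L : latin n) := col_switch (latin_pos L i a) (latin_pos L i b) a L.
have posf L : (latin_pos (f L) i b = latin_pos L i a) *
              (latin_pos (f L) i a = latin_pos L i b).
  by split; apply: latin_pos_uniq; rewrite col_switchE latin_posK porbit_id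
     ?tpermL ?tpermR latin_posK.
have f_inj : injective f.
  move=> L1 L2 eq_f; have [p1 q1] := posf L1; have [p2 q2] := posf L2.
  rewrite eq_f p2 in p1; rewrite eq_f q2 in q1.
  by move: eq_f; rewrite /f p1 q1; apply/can_inj/col_switchK.
rewrite -(card_imset _ f_inj); apply/subset_leq_card/fintype.subsetP => _ /imsetP[L + ->].
rewrite !inE => /andP[/eqP <- sepL]; rewrite /f.
by have := sigma_col_switch sepL; rewrite !latin_posK => ->.
Qed.

(* Switching the row cycle of [b] multiplies the permutation taking column [c]
   to column [d] by a transposition, which separates rows [i] and [j] if they
   were in the same cycle. *)
Lemma separated_switch (L : latin n) a b :
  a \notin porbit (sigma L i j) b ->
  separated L (latin_pos L i a) (latin_pos L i b) ||
  separated (switch i j b L) (latin_pos (switch i j b L) i a)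
    (latin_pos (switch i j b L) i (sigma L i j b)).
Proof.
move=> ab; set L' := switch i j b L; set c := latin_pos L i a; set d := latin_pos L i b.
have Lic : val L i c = a by apply: latin_posK.
have Lid : val L i d = b by apply: latin_posK.
have L'c r : val L' r c = val L r c by rewrite switchE Lic (negPf ab).
have L'd r : val L' r d = val L (tperm i j r) d by rewrite switchE Lid porbit_id.
rewrite (@latin_pos_uniq n L' i a c) ?L'c //.
(* Column [d] of row [i] now holds the old entry of row [j], so [sigma L i j b] takes over the part
   of [b]. *)
rewrite (@latin_pos_uniq n L' i _ d); last by rewrite L'd tpermL -Lid sigmaE.
rewrite /separated !L'c Lic; set a' := val L j c.
have -> : sigma (latin_tr L') c d = (tperm a a' * sigma (latin_tr L) c d)%g.
  apply: sigma_uniq => r; rewrite !mxE L'c L'd permM -Lic.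
  rewrite -(inj_tperm _ _ _ (@latin_col_inj n L c)).
  have := sigmaE (latin_tr L) c d (tperm i j r).
  by rewrite !mxE.
rewrite porbit_sym.
have neq_a : a != a' by rewrite -Lic (inj_eq (@latin_col_inj n L c)).
rewrite [X in _ || ~~ X]porbit_sym.
set t := sigma (latin_tr L) c d.
(* If [a] and [a'] shared a cycle both in [t] and in [tperm a a' * t], each permutation would have
   one cycle more than the other. *)
have := porbits_mul_tperm t a a'.
have := porbits_mul_tperm (tperm a a' * t)%g a a'.
rewrite /= tpermKg neq_a; do 2!case: (a \in _) => //=.
by lia.
Qed.

Lemma num_latin_merge (s : {perm 'I_n}) a b : a \notin porbit s b ->
  num_latin s <= num_latin (tperm a b * s)%g +
                 num_latin (tperm a (s b) * porbit_reverse s b)%g.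
Proof.
move=> ab; apply: leq_trans (leq_add (card_separated _ _ _) (card_separated _ _ _)).
rewrite -[X in _ + X](card_imset _ (can_inj (switchK i j b))).
rewrite -cardsUI; apply: leq_trans (leq_addr _ _).
apply/subset_leq_card/fintype.subsetP => L; rewrite !inE => /eqP sL; rewrite sL eqxx /=.
have := @separated_switch L a b; rewrite sL => /(_ ab) /orP[-> //|sep].
apply/orP; right; apply/imsetP; exists (switch i j b L); last by rewrite switchK.
by rewrite inE sigma_switch sL eqxx.
Qed.

Lemma card_porbits_merge (s : {perm 'I_n}) a b : a \notin porbit s b ->
  #|porbits (tperm a b * s)%g|.+1 = #|porbits s|.
Proof.
move=> ab; have := porbits_mul_tperm s a b.
have -> : a != b by apply: contraNneq ab => ->; apply: porbit_id.
by rewrite /= ab addn2 addn1 => -[].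
Qed.

Definition max_cyclic := \max_(s : {perm 'I_n} | #|porbits s| == 1) num_latin s.

Lemma num_latin_le (s : {perm 'I_n}) :
  num_latin s <= 2 ^ #|porbits s| * max_cyclic.
Proof.
have [k Ek] : exists k, #|porbits s| = k.+1.
  exists #|porbits s|.-1; rewrite prednK // card_gt0; apply/set0Pn.
  by exists (porbit s i); apply: imset_f.
suff /leq_trans : num_latin s <= 2 ^ k * max_cyclic.
  by apply; rewrite leq_mul // leq_exp2l // Ek.
elim: k s Ek => [|k IHk] s Es.
  by rewrite mul1n; apply: (@leq_bigmax_cond _ _ num_latin); rewrite Es.
have /card_gt1P[_ [_ [/imsetP[a _ ->] /imsetP[b _ ->] ab]]] : 1 < #|porbits s|.
  by rewrite Es.
rewrite eq_porbit_mem in ab.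
apply: leq_trans (num_latin_merge ab) _.
rewrite expnS -mulnA mul2n -addnn; apply: leq_add; apply: IHk.
  by have := card_porbits_merge ab; rewrite Es => -[].
(* Reversal keeps the cycle supports, and [s b] lies in the cycle of [b], hence not in that of
   [a]. *)
have := @card_porbits_merge (porbit_reverse s b) a (s b).
rewrite porbits_porbit_reverse porbit_porbit_reverse Es.
rewrite -[s b]/((s ^+ 1)%g b) porbit_perm => /(_ ab) -[//].
Qed.

(** * Conjugation by relabelling, and the bound on n-cycles *)

Definition latin_relabel (g : {perm 'I_n}) (L : latin n) : latin n :=
  insubd L (map_mx g (val L)).

Lemma latin_relabelE g (L : latin n) r e :
  val (latin_relabel g L) r e = g (val L r e).
Proof.
rewrite insubdK ?mxE //; apply/is_latinP; split=> [k|k] x y; rewrite !mxE;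
  by move/perm_inj/(@latin_row_inj n L) || move/perm_inj/(@latin_col_inj n L).
Qed.

Lemma num_latin_conj (s g : {perm 'I_n}) : num_latin s <= num_latin (s ^ g)%g.
Proof.
have g_inj : injective (latin_relabel g).
  move=> L L' eqL; apply/val_inj/matrixP=> r e; apply: (@perm_inj _ g).
  by rewrite -!latin_relabelE eqL.
rewrite /num_latin -[X in X <= _](card_imset _ g_inj).
apply/subset_leq_card/fintype.subsetP => _ /imsetP[L + ->].
rewrite !inE => /eqP <-; apply/eqP/sigma_uniq => e.
by rewrite !latin_relabelE permJ sigmaE.
Qed.

(** A conjugator [g] is determined by [g i]: every point is some [(s ^+ k) i], which [g] sends to
    [(t ^+ k) (g i)]. *)
Lemma card_conj_cyclic (s t : {perm 'I_n}) : #|porbits s| = 1 ->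
  #|[set g | s ^ g == t]%g| <= n.
Proof.
move=> s1; rewrite -[X in _ <= X]card_ord.
apply: (@leq_card_in _ _ (fun g : {perm 'I_n} => g i)) => //.
move=> g h; rewrite !inE => /eqP gt /eqP ht /= eq_gh.
apply/permP=> x.
have /porbitP[k ->] : x \in porbit s i.
  rewrite -eq_porbit_mem; have /eqP/cards1P[B EB] := s1.
  have inB y : porbit s y = B by apply/set1P; rewrite -EB imset_f.
  by rewrite !inB.
have conjE f : (s ^ f)%g = t -> f ((s ^+ k)%g i) = (t ^+ k)%g (f i).
  by move=> <-; rewrite -conjXg permJ.
by rewrite !conjE // eq_gh.
Qed.

Lemma sum_num_latin : \sum_(s : {perm 'I_n}) num_latin s = #|{: latin n}|.
Proof.
rewrite -sum1_card (partition_big (fun L => sigma L i j) predT) //=.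
apply: eq_bigr => s _; rewrite /num_latin -sum1_card; apply: eq_bigl => L.
by rewrite inE.
Qed.

(** Sum [num_latin (s ^ g)] over all [g]: each term is at least [num_latin s], and each conjugate
    occurs at most [n] times. *)
Lemma max_cyclic_le : n`! * max_cyclic <= n * #|{: latin n}|.
Proof.
apply: (big_ind (fun m => n`! * m <= n * #|{: latin n}|)).
- by rewrite muln0.
- by move=> x y; rewrite /maxn; case: ifP.
move=> s /eqP s1.
rewrite -sum_num_latin big_distrr /=.
rewrite -card_Sn -sum_nat_const.
apply: (@leq_trans (\sum_(g : {perm 'I_n}) num_latin (s ^ g)%g)).
  by apply: leq_sum => g _; apply: num_latin_conj.
rewrite (partition_big (fun g => s ^ g)%g predT) //=.
apply: leq_sum => t _.
apply: leq_trans (leq_mul (card_conj_cyclic t s1) (leqnn _)).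
rewrite -sum_nat_const; apply: eq_leq.
apply: eq_big => [g|g /eqP -> //]; by rewrite inE.
Qed.

End Merge.

(** * Burnside's lemma for words, and exponential sums over cycle counts *)

Lemma leq_card_factor (T U V : finType) (h : T -> U) (k : T -> V) :
  (forall x y, k x = k y -> h x = h y) -> #|h @: [set: T]| <= #|V|.
Proof.
move=> kh; have kP (u : seq_sub (enum (h @: [set: T]))) :
    exists x, h x == val u.
  have := valP u; rewrite mem_enum => /imsetP[x _ ->].
  by exists x.
have inj_k : injective (fun u => k (xchoose (kP u))).
  move=> u v /= /kh; rewrite (eqP (xchooseP (kP u))) (eqP (xchooseP (kP v))).
  exact: val_inj.
by have := leq_card _ inj_k; rewrite card_seq_sub ?enum_uniq // -cardE.
Qed.

Section Burnside.

Variables n t : nat.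

(** The inverse makes this a right action, as products compose from left to right. *)
Definition perm_word (w : n.-tuple 'I_t) (s : {perm 'I_n}) : n.-tuple 'I_t :=
  [tuple tnth w (s^-1%g i) | i < n].

Lemma perm_word1 : perm_word^~ 1%g =1 id.
Proof.
by move=> w; apply: eq_from_tnth => i; rewrite tnth_mktuple invg1 perm1.
Qed.

Lemma perm_wordM w : act_morph perm_word w.
Proof.
by move=> s u; apply: eq_from_tnth => i; rewrite !tnth_mktuple invMg permM.
Qed.

Canonical word_action := TotalAction perm_word1 perm_wordM.

(** Words with equal letter counts are rearrangements of each other, so an orbit is determined by
    [t] counts, each at most [n]. *)
Lemma card_word_orbits :
  #|orbit word_action [set: {perm 'I_n}] @: [set: n.-tuple 'I_t]| <= n.+1 ^ t.
Proof.
have -> : n.+1 ^ t = #|{: {ffun 'I_t -> 'I_n.+1}}|.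
  by rewrite card_ffun !card_ord.
apply: (@leq_card_factor _ _ _ _
  (fun w : n.-tuple _ => [ffun c => inord (count_mem c w)])) => w v eq_wv.
apply/(@orbit_eqP _ _ word_action [set: {perm 'I_n}]%G).
have /tuple_permP[s ws] : perm_eq w v.
  apply/allP=> c _ /=; apply/eqP.
  have count_le (u : n.-tuple 'I_t) : count_mem c u < n.+1.
    by rewrite ltnS -[X in _ <= X](size_tuple u) count_size.
  have /(congr1 (fun f : {ffun 'I_t -> 'I_n.+1} => nat_of_ord (f c))) := eq_wv.
  by rewrite !ffunE !inordK.
apply/orbitP; exists (s^-1)%g => //; apply/val_inj => /=; rewrite ws.
by apply: eq_map => i /=; rewrite invgK.
Qed.

(** Each assignment of letters to the cycles of [s] gives a word fixed by [s]. *)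
Lemma leq_card_Fix (s : {perm 'I_n}) :
  t ^ #|porbits s| <= #|'Fix_word_action[s]%g|.
Proof.
have memP x : porbit s x \in porbits s by apply: imset_f.
pose f (c : {ffun {B | B \in porbits s} -> 'I_t}) : n.-tuple 'I_t :=
  [tuple c (exist _ (porbit s x) (memP x)) | x < n].
have f_inj : injective f.
  move=> c d eq_cd; apply/ffunP=> -[B Bs]; have /imsetP[x _ defB] := Bs.
  have := congr1 (fun w : n.-tuple 'I_t => tnth w x) eq_cd; rewrite !tnth_mktuple.
  have -> // : exist _ B Bs = exist _ (porbit s x) (memP x)
      :> {B | B \in porbits s}.
  exact: val_inj.
have <- : #|codom f| = t ^ #|porbits s|.
  by rewrite card_codom // card_ffun card_ord card_sig.
apply/subset_leq_card/fintype.subsetP => _ /codomP[c ->].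
apply/afix1P/eq_from_tnth => i; rewrite !tnth_mktuple; congr (c _).
by apply: val_inj => /=; rewrite -(porbit_perm s 1) permKV.
Qed.

Lemma sum_exp_porbits :
  \sum_(s : {perm 'I_n}) t ^ #|porbits s| <= n`! * n.+1 ^ t.
Proof.
have act_word : [acts [set: {perm 'I_n}], on [set: n.-tuple 'I_t] | word_action].
  by apply/actsP=> s _ w; rewrite !inE.
have := Frobenius_Cauchy act_word.
rewrite cardsT card_Sn => FC.
apply: (@leq_trans (\sum_(s : {perm 'I_n}) #|'Fix_word_action[s]%g|)).
  by apply: leq_sum => s _; apply: leq_card_Fix.
rewrite mulnC; apply: leq_trans (leq_mul card_word_orbits (leqnn _)).
rewrite -FC; apply: eq_leq; apply: eq_big => s; rewrite ?inE // => _.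
by rewrite finset.setTI.
Qed.

End Burnside.

(** * Probability of having only short row cycles *)

Lemma latin_nonempty n : 0 < #|{: latin n}|.
Proof.
case: n => [|n].
  apply/card_gt0P; have latL : is_latin (\matrix_(i < 0, j < 0) i)%R.
    by apply/is_latinP; split=> -[].
  by exists (exist (@is_latin 0) _ latL).
have latL : is_latin (\matrix_(i, j) (i + j)%R : 'M['I_n.+1]_n.+1)%R.
  apply/is_latinP; split=> i x y; rewrite !mxE;
    by [apply: GRing.addrI | apply: GRing.addIr].
by apply/card_gt0P; exists (exist (@is_latin n.+1) _ latL).
Qed.

Lemma sum_card_porbits n (s : {perm 'I_n}) : \sum_(B in porbits s) #|B| = n.
Proof.
have act_s : [acts <[s]>%g, on [set: 'I_n] | 'P] by apply/actsP=> u _ x; rewrite !inE.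
have := acts_sum_card_orbit act_s; rewrite cardsT card_ord => sum_n.
rewrite -[RHS]sum_n; apply: eq_bigl => B.
by apply/imsetP/imsetP=> -[x _ ->]; exists x; rewrite ?porbitE ?inE.
Qed.

Lemma card_row_cycle n (L : latin n) i (B : {set 'I_n}) :
  #|[set c | val L i c \in B]| = #|B|.
Proof. exact: card_preimset (@latin_row_inj n L i). Qed.

Local Open Scope classical_set_scope.
Local Open Scope ring_scope.

Section ShortCycles.

Variables (R : realType) (n : nat) (x : R) (i j : 'I_n).
Hypotheses (i0 : i = 0%N :> nat) (j1 : j = 1%N :> nat).

Lemma short_row_cycles (L : latin n) :
  L \notin long_row_cycle n x -> n%:R <= #|porbits (sigma L i j)|%:R * x.
Proof.
rewrite inE negb_exists => /forallP/(_ i); rewrite negb_exists => /forallP/(_ j).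
rewrite i0 j1 !eqxx /= negb_exists => /forallP short.
rewrite -{1}(sum_card_porbits (sigma L i j)) natr_sum mulr_natl -sumr_const.
apply: ler_sum => B Bs; apply/ltW; have := short [set c | val L i c \in B]%SET.
rewrite negb_and -ltNge card_row_cycle => /orP[/negP[]|//].
exact: imset_f.
Qed.

Hypothesis x_gt0 : 0 < x.

Lemma card_short_row_cycles q : (0 < q)%N ->
  #|~: long_row_cycle n x|%:R <=
  n%:R * n.+1%:R ^+ (2 * q) * expR (- (n%:R / x * ln q%:R)) * #|{: latin n}|%:R :> R.
Proof.
move=> q_gt0.
have neq_ij : i != j by rewrite -val_eqE /= i0 j1.
set E := expR _; set M := max_cyclic i j.
pose bad (s : {perm 'I_n}) := n%:R <= #|porbits s|%:R * x :> R.
have card_bad : (#|~: long_row_cycle n x| <= \sum_(s | bad s) 2 ^ #|porbits s| * M)%N.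
  rewrite -sum1_card (partition_big (fun L => sigma L i j) bad) /=; last first.
    by move=> L; rewrite inE => /short_row_cycles.
  apply: leq_sum => s _; apply: leq_trans (num_latin_le neq_ij s).
  rewrite sum1_card /num_latin; apply/subset_leq_card/fintype.subsetP => L.
  by rewrite [L \in [set _ | _]%SET]inE => /andP[].
(* Here [E] is q^(-n/x), and a bad [s] has at least n/x cycles, so q to the number of cycles times
   [E] is at least 1. *)
have exp_bad s : bad s -> 2 ^+ #|porbits s| <= (2 * q)%:R ^+ #|porbits s| * E.
  move=> bad_s; rewrite natrM exprMn -mulrA ler_peMr ?exprn_ge0 //.
  have q0 : 0 < q%:R :> R by rewrite ltr0n.
  rewrite -{1}(lnK q0) -expRM_natl -expRD -[leLHS]expR0 ler_expR subr_ge0.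
  by rewrite ler_wpM2r ?ln_ge0 ?ler1n // ler_pdivrMr.
have fact0 : 0 < n`!%:R :> R by rewrite ltr0n fact_gt0.
rewrite -(ler_pM2l fact0).
have := leq_mul (leqnn n`!) card_bad; rewrite -(ler_nat R) !natrM => /le_trans; apply.
rewrite -big_distrl natrM /= mulrCA -natrM.
have sum_le : (\sum_(s | bad s) 2 ^ #|porbits s|)%N%:R <=
    n`!%:R * n.+1%:R ^+ (2 * q) * E :> R.
  have := sum_exp_porbits n (2 * q); rewrite -(ler_nat R) natrM natrX => sum_le.
  apply: le_trans (ler_wpM2r (expR_ge0 _) sum_le).
  rewrite !natr_sum mulr_suml big_mkcond; apply: ler_sum => s _.
  case: ifP => [bad_s|_]; last by rewrite mulr_ge0 ?expR_ge0.
  by rewrite !natrX exp_bad.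
have max_le : (n`! * M)%:R <= (n * #|{: latin n}|)%:R :> R.
  by rewrite ler_nat max_cyclic_le.
apply: le_trans (ler_pM _ _ sum_le max_le) _ => //.
rewrite natrM le_eqVlt; apply/orP; left; apply/eqP; ring.
Qed.

Lemma pr_short_row_cycles q : (0 < q)%N ->
  0 <= 1 - uniform_pr R (long_row_cycle n x) <=
  n%:R * n.+1%:R ^+ (2 * q) * expR (- (n%:R / x * ln q%:R)).
Proof.
move=> q_gt0; rewrite /uniform_pr.
have T0 : 0 < #|{: latin n}|%:R :> R by rewrite ltr0n latin_nonempty.
have -> : 1 - #|long_row_cycle n x|%:R / #|{: latin n}|%:R =
          #|~: long_row_cycle n x|%:R / #|{: latin n}|%:R :> R.
  rewrite -(cardsC (long_row_cycle n x)) natrD in T0 *.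
  by field; rewrite gt_eqF.
rewrite divr_ge0 //= ler_pdivrMr //.
exact: card_short_row_cycles.
Qed.

End ShortCycles.

(** * Asymptotics *)

Lemma short_cycles_bound_exp (R : realType) (n : nat) (eps r : R) :
  100%:R <= r -> n%:R = r ^+ 8 -> 3%:R <= ln n%:R `^ eps ->
  exists2 q : nat, (0 < q)%N &
  n%:R * n.+1%:R ^+ (2 * q) *
    expR (- (n%:R / (Num.sqrt n%:R * ln n%:R `^ (1 - eps)) * ln q%:R)) <=
  expR (- r) * expR (- (1 / 4%:R) * Num.sqrt n%:R).
Proof.
move=> r_ge nE ln_ge.
have r0 : 0 < r by lra.
have sqrt_n : Num.sqrt n%:R = r ^+ 4.
  by rewrite nE (exprM r 4 2) sqrtr_sqr ger0_norm // exprn_ge0 // ltW.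
have r2_ge0 : 0 <= r ^+ 2 by rewrite exprn_ge0 ?ltW.
(* With n = r^8, this [q] lies between n^(1/4) = r^2 and 2 r^2, so ln q is at least (ln n)/4 while
   (n+1)^(2q) costs only exp(36 r^3). *)
exists (Num.truncn (r ^+ 2)).+1 => //; set q := (Num.truncn (r ^+ 2)).+1.
have /andP[q_le q_gt] := truncn_itv r2_ge0.
have r2_ge1 : 1 <= r ^+ 2 by rewrite exprn_ege1 //; lra.
have {q_le}q_le : q%:R <= 2 * r ^+ 2.
  by rewrite /q -natr1; lra.
have q_gt0 : 0 < q%:R :> R by rewrite ltr0n.
have n_gt0 : 0 < n%:R :> R by rewrite nE exprn_gt0.
have ln_r : ln n%:R = 8%:R * ln r by rewrite nE lnXn // mulr_natl.
have lnr_gt0 : 0 < ln r by rewrite ln_gt0; lra.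
have ln_gt0 : 0 < ln n%:R :> R by rewrite ln_r mulr_gt0.
have ln_q : ln n%:R / 4%:R <= ln q%:R :> R.
  have : ln (r ^+ 2) <= ln q%:R by rewrite ler_ln ?posrE ?exprn_gt0 // ltW.
  by rewrite lnXn // -mulr_natl ln_r; lra.
have r_exp : r <= expR r by apply: (le_trans _ (expR_ge1Dx r)); lra.
have n_exp : n%:R <= expR (8%:R * r).
  by rewrite expRM_natl nE lerXn2r ?nnegrE ?expR_ge0 ?(ltW r0).
have n1_exp : n.+1%:R <= expR (9%:R * r).
  rewrite expRM_natl; apply: (@le_trans _ _ (r ^+ 9)); last first.
    by rewrite lerXn2r ?nnegrE ?expR_ge0 ?(ltW r0).
  rewrite -natr1 exprS -nE.
  have : 1 <= n%:R :> R by rewrite ler1n -(ltr0n R).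
  nra.
have n1q_exp : n.+1%:R ^+ (2 * q) <= expR (36%:R * r ^+ 3).
  apply: (@le_trans _ _ (expR (9%:R * r) ^+ (2 * q))).
    by rewrite lerXn2r ?nnegrE ?expR_ge0.
  rewrite -expRM_natl ler_expR natrM.
  have -> : 36%:R * r ^+ 3 = 9%:R * r * (4%:R * r ^+ 2) by ring.
  rewrite mulrC ler_pM2l; lra.
(* The gain is r^4 (ln n)^eps (ln q)/(ln n), where (ln n)^eps is at least 3. *)
have main : 3%:R / 4%:R * r ^+ 4 <=
    n%:R / (Num.sqrt n%:R * ln n%:R `^ (1 - eps)) * ln q%:R.
  have -> : n%:R / (Num.sqrt n%:R * ln n%:R `^ (1 - eps)) * ln q%:R =
            r ^+ 4 * (ln n%:R `^ eps / ln n%:R * ln q%:R).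
    rewrite powRD; last by rewrite (gt_eqF ln_gt0) implybT.
    rewrite powRr1 ?ltW // powRN sqrt_n nE; field.
    by rewrite !gt_eqF ?powR_gt0 // -?nE.
  rewrite mulrC ler_pM2l ?exprn_gt0 //.
  have -> : 3%:R / 4%:R = 3%:R / ln n%:R * (ln n%:R / 4%:R) :> R.
    by field; rewrite gt_eqF.
  by rewrite ler_pM ?divr_ge0 ?ler_pM2r ?invr_gt0 // ltW.
rewrite -expRD.
apply: (@le_trans _ _ (expR (8%:R * r + 36%:R * r ^+ 3 - 3%:R / 4%:R * r ^+ 4))).
  rewrite !expRD; apply: ler_pM; rewrite ?mulr_ge0 ?expR_ge0 ?exprn_ge0 //.
    by apply: ler_pM; rewrite ?exprn_ge0.
  by rewrite ler_expR lerN2.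
rewrite ler_expR sqrt_n.
have -> : r ^+ 4 = r * r ^+ 3 by rewrite exprS.
have : r * 1 <= r * r ^+ 2 by rewrite ler_pM2l // exprn_ege1; lra.
rewrite mulr1 -exprS => r3.
(* After reserving r^4/4 for the target, r^4/2 remains; it is at least 50 r^3, which covers 36 r^3 +
   9 r. *)
have : 100%:R * r ^+ 3 <= r * r ^+ 3 by rewrite ler_pM2r ?exprn_gt0.
lra.
Qed.

Theorem theorem2p7 (R : realType) (eps : R) (eps_gt0 : 0 < eps) :
  (fun n : nat => 1 - uniform_pr R
     (long_row_cycle n (Num.sqrt n%:R * ln n%:R `^ (1 - eps))))
  =o_\oo (fun n : nat => expR (- (1 / 4%:R) * Num.sqrt n%:R)).
Proof.
apply/eqoP => d d_gt0.
(* The bound 100 is needed for [short_cycles_bound_exp]; r at least 1/d makes the spare factor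
   exp(-r) at most d. *)
pose b := Num.max 100%:R d^-1.
near=> n.
have n_ge : b ^+ 8 <= n%:R by near: n; apply: nbhs_infty_ger.
(* This threshold is where (ln n)^eps reaches 3. *)
have n_ge_exp : expR (3%:R `^ eps^-1) <= n%:R :> R by near: n; apply: nbhs_infty_ger.
pose r : R := Num.sqrt (Num.sqrt (Num.sqrt n%:R)).
have nE : n%:R = r ^+ 8.
  by rewrite (exprM r 2 4) sqr_sqrtr ?sqrtr_ge0 // (exprM _ 2 2) !sqr_sqrtr ?sqrtr_ge0.
have r_ge : b <= r.
  by rewrite -(@ler_pXn2r _ 8) ?nnegrE ?sqrtr_ge0 -?nE // le_max ler0n.
have [r_ge100 r_ged] : 100%:R <= r /\ d^-1 <= r.
  by move: r_ge; rewrite ge_max => /andP[].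
have n_gt0 : 0 < n%:R :> R by apply: lt_le_trans n_ge_exp; apply: expR_gt0.
have ln_ge : 3%:R `^ eps^-1 <= ln n%:R :> R.
  by rewrite -[leLHS]expRK ler_ln ?posrE ?expR_gt0.
have ln_gt0 : 0 < ln n%:R :> R by apply: lt_le_trans ln_ge; rewrite powR_gt0.
have lneps_ge : 3%:R <= ln n%:R `^ eps :> R.
  have -> : 3%:R = (3%:R `^ eps^-1) `^ eps :> R.
    by rewrite -powRrM mulVf ?gt_eqF // powRr1.
  by apply: ge0_ler_powR; rewrite ?nnegrE ?powR_ge0 // ltW.
have [q q_gt0 le_q] := short_cycles_bound_exp r_ge100 nE lneps_ge.
have n_gt1 : (1 < n)%N.
  have : 1 < r ^+ 8 by rewrite exprn_egt1 //; lra.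
  by rewrite -nE ltr1n.
pose i := Ordinal (ltnW n_gt1); pose j := Ordinal n_gt1.
have x_gt0 : 0 < Num.sqrt n%:R * ln n%:R `^ (1 - eps) :> R.
  by rewrite mulr_gt0 ?sqrtr_gt0 ?powR_gt0.
have /andP[pr_ge0 pr_le] := @pr_short_row_cycles R n _ i j erefl erefl x_gt0 q q_gt0.
rewrite /= ger0_norm // ger0_norm ?expR_ge0 //.
apply: le_trans pr_le (le_trans le_q _).
rewrite ler_wpM2r ?expR_ge0 // expRN invf_ple ?posrE ?expR_gt0 //.
by apply: le_trans r_ged (le_trans _ (expR_ge1Dx r)); lra.
Unshelve. all: by end_near.
Qed.
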